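(* Let $G$ and $H$ be finite simple graphs, let $\Gamma$ be a cycle cover of $G$ containing exactly $k$ vertex-cycles, let $U\subseteq V(H)$, and let $n=|V(G)|$. Then: (i) $I(G^\Gamma\otimes H^U;x)=I^{n+k}(H;x)\,I\!\left(G;\frac{x\,I^2(H-U;x)}{I^2(H;x)}\right)$; (ii) if $\alpha(H)=\alpha(H-U)+1$ and both $I(H;x)$ and $I(H-U;x)$ are symmetric, then $I(G^\Gamma\otimes H^U;x)$ is symmetric; (iii) if $\alpha(H)=\alpha(H-U)+1$ and both $I(H;x)$ and $I(H-U;x)$ are symmetric and unimodal, then $I(G^\Gamma\otimes H^U;x)$ is symmetric and unimodal; (iv) if $I(G;x)$ has only real zeros and $I(H;x)=I(H-U;x)(1+ax)$, then $I(G^\Gamma\otimes H^U;x)$ has only real zeros; (v) if $I(G;x)$ has only real zeros and $H=K_p$, then $I(G^\Gamma\otimes K_p^{V(K_p)};x)$ has only real zeros.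
   Context: For a finite simple graph $G$, $i_k(G)$ is the number of independent sets of size $k$ ($i_0(G)=1$), $\alpha(G)$ is the maximum size of an independent set, and $I(G;x)=\sum_{k=0}^{\alpha(G)} i_k(G)x^k$; $H-U$ is the subgraph induced on $V(H)\setminus U$, and $I^m$ denotes the $m$-th power. A cycle cover $\Gamma$ of $G$ is a spanning subgraph of $G$ each of whose connected components is a single vertex (a vertex-cycle), a single edge (an edge-cycle), or a cycle (a proper cycle). The cycle cover product $G^\Gamma\otimes H^U$ is constructed from $G$ as follows: for each vertex-cycle $v$, add two disjoint copies of $H$ and join each vertex of both copies of $U$ to $v$; for each edge-cycle $uv$, add two disjoint copies of $H$ and join each vertex of both copies of $U$ to both $u$ and $v$; for each proper cycle $C$ with vertices $v_1,\dots,v_s$ and edges $v_iv_{i+1}$ ($1\le i\le s-1$) and $v_1v_s$, add $s$ disjoint copies $H_1,\dots,H_s$ of $H$ and join each vertex of the copy of $U$ in $H_i$ to $v_i$ and $v_{i+1}$ for $1\le i\le s-1$, and each vertex of the copy of $U$ in $H_s$ to $v_s$ and $v_1$. A polynomial $\sum_{k=0}^n a_kx^k$ of degree $n$ with nonnegative coefficients is symmetric if $a_k=a_{n-k}$ for all $k$, and unimodal if $a_0\le\cdots\le a_m\ge\cdots\ge a_n$ for some $m$.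
   Formalization: Part (iv) additionally assumes that I(H;x) has only real zeros; as printed it fails, e.g. for G=K_1 and H=K_{1,3} plus an isolated vertex w with U={w}, a=1, and for n≥1 the added hypothesis is necessary. *)

(* Defs.v *)
From HB Require Import structures.
From mathcomp Require Import all_boot all_order all_algebra fraction.
From mathcomp Require Import reals complex.
Set Implicit Arguments.
Unset Strict Implicit.
Unset Printing Implicit Defensive.
Import Order.TTheory GRing.Theory Num.Theory.
Local Open Scope ring_scope.

Record sgraph := SGraph {
  svertex :> finType;
  sedge : rel svertex;
  sedge_sym : symmetric sedge;
  sedge_irrefl : irreflexive sedge
}.

Definition independent (G : sgraph) (A : {set G}) : bool :=
  [forall x in A, forall y in A, ~~ sedge x y].

Definition indep_count (G : sgraph) (k : nat) : nat :=
  #|[set A : {set G} | independent A & #|A| == k]|.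

Definition alpha (G : sgraph) : nat :=
  \max_(A : {set G} | independent A) #|A|.

Definition indep_poly (R : nzRingType) (G : sgraph) : {poly R} :=
  \poly_(k < (alpha G).+1) (indep_count G k)%:R.

Section DeleteVertices.
Variables (H : sgraph) (U : {set H}).

Definition delete_rel : rel {x : H | x \notin U} :=
  [rel x y | sedge (val x) (val y)].

Fact delete_sym : symmetric delete_rel.
Proof. by move=> x y; apply: sedge_sym. Qed.

Fact delete_irrefl : irreflexive delete_rel.
Proof. by move=> x; apply: sedge_irrefl. Qed.

Definition delete_vertices := SGraph delete_sym delete_irrefl.
End DeleteVertices.

Section CompleteGraph.
Variable p : nat.

Fact complete_sym : symmetric [rel i j : 'I_p | i != j].
Proof. by move=> i j; rewrite /= eq_sym. Qed.

Fact complete_irrefl : irreflexive [rel i j : 'I_p | i != j].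
Proof. by move=> i; rewrite /= eqxx. Qed.

Definition complete_graph := SGraph complete_sym complete_irrefl.
End CompleteGraph.

Section Components.
Variables (T : finType) (c : rel T).

Definition component (v : T) : {set T} := [set w | connect c v w].

Definition components : {set {set T}} := [set component v | v : T].

(* The conjunct on [c] is what excludes chords: the edges of [c] between
   vertices of [A] are exactly the consecutive pairs of the cyclic sequence. *)
Definition is_cycle_on (A : {set T}) : Prop :=
  exists s : seq T,
    [/\ uniq s, (2 < size s)%N, A = [set x in s] &
        {in s &, forall x y, c x y = (y == next s x) || (x == next s y)}].
End Components.

(* A spanning subgraph is given by its edges.  In a component with one (resp.
   two) vertices the subgraph is necessarily a single vertex (resp. a single
   edge), since it is loopless and connected there. *)
Record cycle_cover (G : sgraph) := CycleCover {
  cover_edge :> rel G;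
  cover_sym : symmetric cover_edge;
  cover_sub : subrel cover_edge (@sedge G);
  cover_components : forall A, A \in components cover_edge ->
    [\/ #|A| = 1%N, #|A| = 2%N | is_cycle_on cover_edge A]
}.

Section CycleCoverProduct.
Variables (G H : sgraph) (Gamma : cycle_cover G) (U : {set H}).

Definition vertex_cycles : {set {set G}} :=
  [set A in components Gamma | #|A| == 1%N].

Definition edge_cycles : {set {set G}} :=
  [set A in components Gamma | #|A| == 2%N].

Definition proper_cycle_edges : {set {set G}} :=
  [set A : {set G} | [exists u, exists v,
     [&& Gamma u v, (2 < #|component Gamma u|)%N & A == [set u; v]]]].

(* Names of the copies of [H]: two for each vertex-cycle, two for each
   edge-cycle, and one for each edge [v_i v_(i+1)] of each proper cycle. *)
Definition copy : finType :=
  ({A | A \in vertex_cycles} * bool + {A | A \in edge_cycles} * bool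
   + {A | A \in proper_cycle_edges})%type.

(* The vertices of [G] to which the [U] of a given copy is joined. *)
Definition anchor (i : copy) : {set G} :=
  match i with
  | inl (inl (A, _)) => val A
  | inl (inr (A, _)) => val A
  | inr A => val A
  end.

Definition product_rel : rel (G + copy * H)%type := fun a b =>
  match a, b with
  | inl x, inl y => sedge x y
  | inl x, inr (i, h) => (x \in anchor i) && (h \in U)
  | inr (i, h), inl x => (x \in anchor i) && (h \in U)
  | inr (i, h), inr (j, h') => (i == j) && sedge h h'
  end.

Fact product_sym : symmetric product_rel.
Proof.
move=> [x|[i h]] [y|[j h']] //=; first by rewrite sedge_sym.
by rewrite eq_sym sedge_sym.
Qed.

Fact product_irrefl : irreflexive product_rel.
Proof. by move=> [x|[i h]] /=; rewrite sedge_irrefl ?andbF. Qed.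

Definition cycle_cover_product := SGraph product_sym product_irrefl.
End CycleCoverProduct.

Section PolynomialProperties.
Variable R : realType.

Definition degree (p : {poly R}) : nat := (size p).-1.

Definition symmetric_poly (p : {poly R}) : Prop :=
  forall k, (k <= degree p)%N -> p`_k = p`_(degree p - k).

Definition unimodal_poly (p : {poly R}) : Prop :=
  exists m, [/\ (m <= degree p)%N,
    forall k, (k < m)%N -> p`_k <= p`_k.+1 &
    forall k, (m <= k < degree p)%N -> p`_k.+1 <= p`_k].

Definition only_real_zeros (p : {poly R}) : Prop :=
  forall z : R[i], root (map_poly (real_complex R) p) z -> z \is Num.real.

(* The element p(f) of R(x), for a polynomial p and a rational function f. *)
Definition subst_frac (p : {poly R}) (f : {fraction {poly R}})
    : {fraction {poly R}} :=
  (map_poly (fun a : R => tofrac a%:P) p).[f].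
End PolynomialProperties.

(* Main.v *)
Require Import Defs.
From mathcomp Require Import all_boot all_order all_algebra fraction.
From mathcomp Require Import zify ring lra.
From mathcomp Require Import reals complex.
Set Implicit Arguments.
Unset Strict Implicit.
Unset Printing Implicit Defensive.
Import Order.TTheory GRing.Theory Num.Theory.
Local Open Scope ring_scope.

(* Every vertex of [G] is joined to exactly two of the copies of [H], and by
   double counting there are [n + k] copies.  The vertices joined to a given
   copy form a clique, so an independent set [S] of [G] blocks exactly [2 |S|]
   copies; a blocked copy contributes [I(H - U)] and any other one [I(H)], so
   that the independence polynomial of the product is
     sum_S x^|S| I(H - U)^(2 |S|) I(H)^(n + k - 2 |S|),
   which is (i).  For (ii) and (iii) all these summands are palindromic (and
   unimodal) about the same center.  For (iv), a zero [z] outside the zeros of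
   [I(H)] makes [z / (1 + a z)^2] a zero of [I(G)], hence a negative real, which
   forces [z] to be real. *)

(** * Independence polynomials as sums over independent sets *)

Lemma indep_polyE (R : nzRingType) (G : sgraph) :
  indep_poly R G = \sum_(A : {set G} | independent A) 'X^#|A|.
Proof.
apply/polyP => k; rewrite coef_poly coef_sum ltnS.
under eq_bigr => A _ do rewrite coefXn.
rewrite -natr_sum -big_mkcondr /= sum1_card.
have -> : #|[pred A : {set G} | independent A & k == #|A|]| = indep_count G k.
  by rewrite /indep_count -sum1dep_card sum1_card; apply: eq_card => A;
     rewrite !inE eq_sym.
(* Beyond [alpha G] there is nothing to count, so the truncation in [indep_poly] loses no term. *)
case: leqP => // k_gt; rewrite (_ : indep_count G k = 0%N) //; apply/eqP.
rewrite cards_eq0; apply/eqP/setP => A; rewrite !inE.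
apply/negbTE/negP => /andP[Aind /eqP Ak].
by move: k_gt; rewrite -Ak ltnNge (leq_bigmax_cond _ Aind).
Qed.

Lemma independent0 (G : sgraph) : independent (set0 : {set G}).
Proof. by apply/forall_inP => x; rewrite inE. Qed.

Lemma coef_indep_poly_ge0 (R : numDomainType) (G : sgraph) i :
  0 <= (indep_poly R G)`_i.
Proof. by rewrite coef_poly; case: ifP. Qed.

Lemma coef0_indep_poly (R : nzRingType) (G : sgraph) :
  (indep_poly R G)`_0 = 1.
Proof.
rewrite coef_poly /= /indep_count (_ : [set A | _] = [set set0]) ?cards1 //.
apply/setP => A; rewrite !inE cards_eq0 andbC.
by case: eqP => // ->; rewrite independent0.
Qed.

Lemma indep_poly_neq0 (R : nzRingType) (G : sgraph) : indep_poly R G != 0.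
Proof.
by apply/eqP => /(congr1 (fun p : {poly R} => p`_0));
   rewrite coef0_indep_poly coef0; apply/eqP/oner_neq0.
Qed.

Lemma size_indep_poly (R : numDomainType) (G : sgraph) :
  size (indep_poly R G) = (alpha G).+1.
Proof.
rewrite size_poly_eq // pnatr_eq0 -lt0n; apply/card_gt0P.
have [A Aind Aalpha] :
    {A : {set G} | independent A & alpha G = #|A|}.
  by apply: eq_bigmax_cond; apply/card_gt0P; exists set0; apply: independent0.
by exists A; rewrite inE Aind Aalpha eqxx.
Qed.

(** The empty set contributes 1 and every other term is nonnegative. This is what makes real zeros
    negative. *)
Lemma indep_poly_gt0 (R : numDomainType) (G : sgraph) (r : R) :
  0 <= r -> 0 < (indep_poly R G).[r].
Proof.
move=> r_ge0; rewrite indep_polyE horner_sum (bigD1 set0) ?independent0 //=.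
rewrite cards0 hornerXn expr0 ltr_pwDl // sumr_ge0 // => A _.
by rewrite hornerXn exprn_ge0.
Qed.

(** [val] matches the independent sets of [H - U] with those of [H] avoiding [U], so both
    polynomials become sums over subsets of [H]. *)
Lemma indep_poly_delete (R : nzRingType) (H : sgraph) (U : {set H}) :
  indep_poly R (delete_vertices U) =
    \sum_(B : {set H} | independent B && [disjoint B & U]) 'X^#|B|.
Proof.
rewrite indep_polyE.
pose f (B : {set H}) : {set delete_vertices U} := val @^-1: B.
have fK (B : {set H}) : [disjoint B & U] -> val @: f B = B.
  move=> dBU; apply/setP => x; apply/imsetP/idP => [[y yB ->]|xB].
    by rewrite inE in yB.
  by exists (Sub x (negbT (disjointFr dBU xB))); rewrite ?inE SubK.
have gK (A : {set delete_vertices U}) : f (val @: A) = A.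
  by apply/setP => x; rewrite inE mem_imset //; apply: val_inj.
rewrite (reindex_onto (fun A : {set delete_vertices U} => val @: A) f) /=; last first.
  by move=> B /andP[_ /fK].
apply: eq_big => [A|A _]; last by rewrite card_imset //; apply: val_inj.
rewrite gK eqxx andbT.
have -> : [disjoint val @: A & U].
  rewrite disjoint_subset; apply/subsetP => _ /imsetP[x _ ->].
  exact: (valP x).
rewrite andbT; apply/forall_inP/forall_inP => Aind x.
  case/imsetP=> x' x'A ->; apply/forall_inP => _ /imsetP[y' y'A ->].
  exact: (forall_inP (Aind x' x'A)).
move=> xA; apply/forall_inP => y yA.
by apply: (forall_inP (Aind (val x) _)); apply: imset_f.
Qed.

(** * Incidences between the vertices of [G] and the copies of [H] *)

Section Incidence.
Local Open Scope nat_scope.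
Variables (G : sgraph) (Gamma : cycle_cover G).

Lemma mem_component v : v \in component Gamma v.
Proof. by rewrite inE connect0. Qed.

Lemma component_eq v w : w \in component Gamma v -> component Gamma w = component Gamma v.
Proof.
have csym := sym_connect_sym (@cover_sym _ Gamma).
by rewrite inE => vw; apply/setP => x; rewrite !inE (same_connect csym vw).
Qed.

Lemma components_eq A v : A \in components Gamma -> v \in A -> A = component Gamma v.
Proof. by case/imsetP=> w _ -> /component_eq. Qed.

Lemma cover_edge_neq u v : Gamma u v -> u != v.
Proof.
by move=> /cover_sub; apply: contraTneq => ->; rewrite sedge_irrefl.
Qed.

(** Kept general in [f] to serve three counts: incidences at a vertex, total size of the anchors,
    and number of copies. *)
Lemma sum_copy (f : {set G} -> nat) :
  \sum_(i : copy Gamma) f (anchor i) =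
    2 * (\sum_(A in vertex_cycles Gamma) f A) +
    2 * (\sum_(A in edge_cycles Gamma) f A) +
    \sum_(A in proper_cycle_edges Gamma) f A.
Proof.
have sum_sub (P : {set {set G}}) :
    \sum_(A : {A | A \in P}) f (val A) = \sum_(A in P) f A.
  by rewrite [RHS]big_sub.
have twice (P : {set {set G}}) :
    \sum_(A : {A | A \in P} * bool) f (val A.1) = 2 * \sum_(A in P) f A.
  rewrite -(pair_bigA _ (fun A (_ : bool) => f (val A))) /= -sum_sub big_distrr /=.
  by apply: eq_bigr => A _; rewrite sum_nat_const card_bool.
rewrite !big_sumType /= -!twice -sum_sub.
by congr (_ + _ + _); apply: eq_bigr => -[].
Qed.

Lemma sum_components_at (m : nat) v :
  \sum_(A in [set A in components Gamma | #|A| == m]) (v \in A) =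
    (#|component Gamma v| == m).
Proof.
have [vm|vm] := boolP (_ == m); last first.
  rewrite big1 // => A; rewrite inE => /andP[Acomp Am].
  apply/eqP; rewrite eqb0; apply: contra vm => vA.
  by rewrite -(components_eq Acomp vA).
rewrite (bigD1 (component Gamma v)) ?inE ?vm ?imset_f //= connect0.
rewrite big1 // => A /andP[]; rewrite inE => /andP[Acomp _] Av.
by apply/eqP; rewrite eqb0; apply: contra Av => /(components_eq Acomp) ->.
Qed.

(** On a proper cycle, [w |-> {v, w}] is a bijection from the neighbours of [v] in [Gamma] to the
    cycle edges at [v]. *)
Lemma sum_proper_cycle_edges_at v :
  \sum_(A in proper_cycle_edges Gamma) (v \in A) =
    if 2 < #|component Gamma v| then #|[set w | Gamma v w]| else 0.
Proof.
rewrite -big_mkcondr /= sum1_card.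
have edgeP A : (A \in proper_cycle_edges Gamma) && (v \in A) ->
    2 < #|component Gamma v| /\ exists2 w, Gamma v w & A = [set v; w].
  rewrite inE => /andP[/existsP[x /existsP[y /and3P[xy x2 /eqP ->]]]].
  rewrite !inE => /orP[] /eqP ->; first by split=> //; exists y.
  split; last by exists x; [rewrite cover_sym|rewrite setUC].
  by rewrite (@component_eq x y) // inE connect1.
case: ifP => v2; last first.
  by apply: eq_card0 => A; rewrite inE; apply/negP => /edgeP[]; rewrite v2.
rewrite -(card_in_imset (f := fun w => [set v; w])) => [|w w']; last first.
  rewrite !inE => /cover_edge_neq vw _ /setP/(_ w).
  by rewrite !inE eqxx orbT eq_sym (negbTE vw) => /esym/eqP.
apply: eq_card => A; apply/idP/imsetP => [/edgeP[_ [w vw ->]]|[w]].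
  by exists w; rewrite ?inE.
rewrite inE => vw ->; apply/andP; split; rewrite !inE ?eqxx //.
by apply/existsP; exists v; apply/existsP; exists w; rewrite vw v2 eqxx.
Qed.

(** The neighbours are the successor and the predecessor of [v], distinct because the cycle has at
    least three vertices. *)
Lemma cycle_degree v :
  is_cycle_on Gamma (component Gamma v) -> #|[set w | Gamma v w]| = 2.
Proof.
case=> s [us s2 Es sP].
have vs : v \in s by have := mem_component v; rewrite Es inE.
have nbrs : [set w | Gamma v w] = [set next s v; prev s v].
  apply/setP => w; rewrite !inE; apply/idP/idP => [vw|].
    have ws : w \in s.
      have : w \in component Gamma v by rewrite inE connect1.
      by rewrite Es inE.
    by move: vw; rewrite sP // => /orP[-> //|/eqP ->]; rewrite prev_next ?eqxx ?orbT.
  case/orP=> /eqP ->; rewrite sP ?mem_next ?mem_prev ?eqxx //.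
  by rewrite next_prev ?eqxx ?orbT.
rewrite nbrs cards2.
suff -> : next s v != prev s v by [].
(* Otherwise two steps forward lead back to [v]; rotating the cycle to start at [v] shows that it
   would have at most two vertices. *)
apply/eqP => nvpv.
have nnv : next s (next s v) = v by rewrite nvpv next_prev.
have /rot_to[i s' sE] := vs.
rewrite -(next_rot i us) in nnv; move: nnv; rewrite -(next_rot i us) sE.
have : size (v :: s') = size s by rewrite -sE size_rot.
have : uniq (v :: s') by rewrite -sE rot_uniq.
case: s' {sE} => [|a [|b s']] /= us' ss; rewrite ?ltnS; try by move: s2; rewrite -ss.
move: us'; rewrite !inE !negb_or eqxx.
case/andP=> /and3P[va vb _] _.
by rewrite eq_sym (negbTE va) eqxx => bv; rewrite bv eqxx in vb.
Qed.

(** A vertex-cycle or edge-cycle through [v] carries two copies; on a proper cycle, [v] has two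
    edges with one copy each. *)
Lemma sum_anchors_at v : \sum_(i : copy Gamma) (v \in anchor i) = 2.
Proof.
rewrite (sum_copy (fun A => (v \in A) : nat)) sum_proper_cycle_edges_at.
rewrite !sum_components_at.
have := @cover_components _ Gamma (component Gamma v) (imset_f _ isT).
case=> [->|->|vcyc] //.
rewrite (cycle_degree vcyc); case: vcyc => s [us s2 -> _].
by rewrite cardsE (card_uniqP us); case: size s2 => [|[|[|]]].
Qed.

(** With [a] vertex-cycles, [b] edge-cycles and [c] edges on proper cycles, double counting
    incidences gives [2a + 4b + 2c = 2|G|], so the [2a + 2b + c] copies number [|G| + a]. *)
Lemma card_copy : #|copy Gamma| = #|G| + #|vertex_cycles Gamma|.
Proof.
have double_count : \sum_(i : copy Gamma) #|anchor i| = 2 * #|G|.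
  under eq_bigr => i _ do rewrite -sum1_card big_mkcond /=.
  rewrite exchange_big /=.
  under eq_bigr => v _ do
    rewrite (eq_bigr (fun i => (v \in anchor i) : nat)) ?sum_anchors_at //.
  by rewrite sum_nat_const mulnC.
rewrite (sum_copy (fun A => #|A|)) in double_count.
have := sum_copy (fun=> 1); rewrite !sum1_card => ->.
move: double_count.
have card_cst m (P : {set {set G}}) : (forall A, A \in P -> #|A| = m) ->
    \sum_(A in P) #|A| = #|P| * m.
  by move=> Pm; rewrite -sum_nat_const; apply: eq_bigr.
rewrite (card_cst 1 (vertex_cycles Gamma)); last first.
  by move=> A; rewrite inE => /andP[_ /eqP].
rewrite (card_cst 2 (edge_cycles Gamma)); last first.
  by move=> A; rewrite inE => /andP[_ /eqP].
rewrite (card_cst 2 (proper_cycle_edges Gamma)); first lia.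
move=> A; rewrite inE => /existsP[u /existsP[v /and3P[/cover_edge_neq uv _ /eqP->]]].
by rewrite cards2 uv.

Qed.

End Incidence.

(** * Independent sets of [G] and the copies that they block *)

Lemma independentP (G : sgraph) (A : {set G}) :
  reflect {in A &, forall x y, ~~ sedge x y} (independent A).
Proof.
apply: (iffP forall_inP) => Aind x => [y xA|xA]; first exact: (forall_inP (Aind x xA)).
by apply/forall_inP => y; apply: Aind.
Qed.

Section Anchors.
Variables (G : sgraph) (Gamma : cycle_cover G).

Lemma anchor_adjacent (i : copy Gamma) :
  {in anchor i &, forall x y, x != y -> sedge x y}.
Proof.
case: i => [[[[A AP] b]|[[A AP] b]]|[A AP]] x y /= xA yA xy.
- move: AP; rewrite inE => /andP[_ /cards1P[z Az]].
  by move: xA yA xy; rewrite Az !inE => /eqP-> /eqP->; rewrite eqxx.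
- move: AP; rewrite inE => /andP[Acomp A2].
  (* The first edge of a path from [x] to [y] stays in the two-element component, so its other end
     is [y]. *)
  move: (yA); rewrite {1}(components_eq Acomp xA) inE => /connectP[[|z p] /=].
    by move=> _ yx; rewrite yx eqxx in xy.
  case/andP=> xz _ _.
  have zA : z \in A by rewrite (components_eq Acomp xA) inE connect1.
  have Axy : [set x; y] = A.
    apply/eqP; rewrite eqEcard cards2 xy (eqP A2) andbT.
    by apply/subsetP => w; rewrite !inE => /orP[] /eqP->.
  move: zA; rewrite -Axy !inE eq_sym (negbTE (cover_edge_neq xz)) => /eqP <-.
  exact: cover_sub xz.
- move: AP; rewrite inE => /existsP[u /existsP[v /and3P[uv _ /eqP Auv]]].
  move: xA yA xy; rewrite Auv !inE => /orP[] /eqP-> /orP[] /eqP->;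
    rewrite ?eqxx // => _; last rewrite sedge_sym; exact: cover_sub uv.
Qed.

(** Anchors are cliques, so each meets [S] at most once: counting blocked copies is counting
    incidences with [S], two for each vertex. *)
Lemma card_blocked (S : {set G}) : independent S ->
  #|[pred i : copy Gamma | ~~ [disjoint S & anchor i]]| = (2 * #|S|)%N.
Proof.
move=> /independentP Sind.
rewrite -[LHS]sum1_card [LHS]big_mkcond /=.
transitivity (\sum_(i : copy Gamma) \sum_(v in S) (v \in anchor i))%N.
  apply: eq_bigr => i _; rewrite -big_mkcondr /= sum1_card unfold_in /=.
  rewrite -setI_eq0 -cards_eq0.
  have -> : #|[pred v in S | v \in anchor i]| = #|S :&: anchor i|.
    by apply: eq_card => v; rewrite !inE.
  have : (#|S :&: anchor i| <= 1)%N.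
    apply/card_le1_eqP => x y; rewrite !inE => /andP[xS xi] /andP[yS yi].
    apply/eqP; apply: contraNT (Sind _ _ xS yS) => yx.
    by apply: (anchor_adjacent xi yi); rewrite eq_sym.
  by case: #|_| => [|[]].
rewrite exchange_big /=; under eq_bigr => v _ do rewrite sum_anchors_at.
by rewrite sum_nat_const mulnC.
Qed.

(** Ensures that the truncated subtractions in the exponents below are exact. *)
Lemma card_independent_le_copy (S : {set G}) :
  independent S -> (2 * #|S| <= #|copy Gamma|)%N.
Proof. by move=> Sind; rewrite -(card_blocked Sind) max_card. Qed.

End Anchors.

(** * Expansion of the independence polynomial of the product *)

Section ProductExpansion.
Variables (G H : sgraph) (Gamma : cycle_cover G) (U : {set H}).
Local Notation P := (cycle_cover_product Gamma U).
Local Notation parts := ({set G} * {ffun copy Gamma -> {set H}})%type.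

Definition glue (p : parts) : {set P} :=
  [set z : P | match z with inl x => x \in p.1 | inr (i, h) => h \in p.2 i end].

Definition unglue (A : {set P}) : parts :=
  ([set x | inl x \in A], [ffun i => [set h | inr (i, h) \in A]]).

Lemma glueK : cancel glue unglue.
Proof.
case=> S f; congr (_, _); first by apply/setP => x; rewrite !inE.
by apply/ffunP => i; rewrite ffunE; apply/setP => h; rewrite !inE.
Qed.

Lemma unglueK : cancel unglue glue.
Proof. by move=> A; apply/setP => -[x|[i h]]; rewrite !inE //= ffunE inE. Qed.

Lemma card_glue p : #|glue p| = (#|p.1| + \sum_i #|p.2 i|)%N.
Proof.
rewrite -sum1_card big_sumType /=; congr (_ + _)%N.
  by rewrite -sum1_card; apply: eq_bigl => x; rewrite inE.
under [RHS]eq_bigr => i _ do rewrite -sum1_card.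
by rewrite pair_big_dep /=; apply: eq_bigl => -[i h]; rewrite inE.
Qed.

(** Distinct copies are not adjacent, and [G] meets copy [i] only through [anchor i] and [U]; so
    once [p.1] is fixed, the copies are constrained separately. *)
Lemma independent_glue p :
  independent (glue p) = independent p.1 &&
    [forall i, independent (p.2 i) &&
       (~~ [disjoint p.1 & anchor i] ==> [disjoint p.2 i & U])].
Proof.
apply/independentP/andP => [ind|[/independentP indS /forallP indf]].
  split; first by apply/independentP => x y xS yS; apply: (ind (inl x) (inl y)); rewrite inE.
  apply/forallP => i; apply/andP; split.
    apply/independentP => h h' hf h'f.
    have := ind (inr (i, h)) (inr (i, h')); rewrite !inE /= eqxx /=; exact.
  apply/implyP => /pred0Pn[x /= /andP[xS xi]].
  rewrite disjoint_subset; apply/subsetP => h hf; rewrite inE; apply/negP => hU.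
  by have := ind (inl x) (inr (i, h)); rewrite !inE /= xi hU => /(_ xS hf).
have mixed x i h : x \in p.1 -> h \in p.2 i -> ~~ ((x \in anchor i) && (h \in U)).
  move=> xS hf; have /andP[_ /implyP blocked] := indf i.
  apply/negP => /andP[xi hU]; have dU : [disjoint p.2 i & U].
    by apply: blocked; apply/pred0Pn; exists x; rewrite /= xS.
  by rewrite (disjointFr dU hf) in hU.
move=> [x|[i h]] [y|[j h']]; rewrite !inE /=.
- exact: indS.
- exact: mixed.
- by move=> hf xS; apply: mixed.
- move=> hf h'f; have [ij|//] := eqVneq i j; subst j.
  by have /andP[/independentP indi _] := indf i; apply: indi.
Qed.

Lemma indep_poly_product (R : comNzRingType) :
  indep_poly R P =
  \sum_(S : {set G} | independent S)
     'X^#|S| * indep_poly R (delete_vertices U) ^+ (2 * #|S|)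
     * indep_poly R H ^+ (#|copy Gamma| - 2 * #|S|).
Proof.
rewrite indep_polyE (reindex glue) /=; last first.
  by exists unglue => p _; [apply: glueK|apply: unglueK].
under eq_bigl => p do rewrite independent_glue.
under eq_bigr => p _ do rewrite card_glue exprD -prodrXr.
pose Q (S : {set G}) (i : copy Gamma) (B : {set H}) := independent B &&
  (~~ [disjoint S & anchor i] ==> [disjoint B & U]).
transitivity (\sum_(S : {set G} | independent S)
    \sum_(f : {ffun copy Gamma -> {set H}} | f \in family (Q S))
      ('X^#|S| * \prod_i 'X^#|f i| : {poly R})).
  by rewrite pair_big_dep.
apply: eq_bigr => S Sind; rewrite -big_distrr /= -mulrA; congr (_ * _).
(* With [S] fixed, distributivity turns the sum over families into a product over copies. *)
rewrite -(bigA_distr_big_dep (Q S) (fun _ B => 'X^#|B|)).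
rewrite (eq_bigr (fun i => if ~~ [disjoint S & anchor i]
           then indep_poly R (delete_vertices U) else indep_poly R H)); last first.
  move=> i _; case: ifP => blocked.
    by rewrite indep_poly_delete; apply: eq_bigl => B; rewrite /Q blocked.
  by rewrite indep_polyE; apply: eq_bigl => B; rewrite /Q blocked andbT.
rewrite big_if !prodr_const (card_blocked Gamma Sind); congr (_ * _ ^+ _).
rewrite -(card_blocked Gamma Sind) -(cardC [pred i | ~~ [disjoint S & anchor i]]) addKn.
by apply: eq_card => i; rewrite !inE.
Qed.

End ProductExpansion.

(** * Cones of palindromic polynomials with a common center *)

Section Centered.
Variable R : comNzRingType.

(** Indexed by the number of terms: [geo m.+1] is the interval of degree [m], and [geo 0] is
    zero. *)
Definition geo (m : nat) : {poly R} := \sum_(i < m) 'X^i.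

Lemma geoD m l : geo (m + l) = geo m + 'X^m * geo l.
Proof.
rewrite /geo big_split_ord /= big_distrr /=; congr (_ + _).
by apply: eq_bigr => i _; rewrite exprD.
Qed.

Lemma geo0 : geo 0 = 0. Proof. by rewrite /geo big_ord0. Qed.
Lemma geo1 : geo 1 = 1. Proof. by rewrite /geo big_ord1. Qed.

(** Splits off the longest interval; what remains is a product of shorter ones, shifted by one and
    hence with the same center. *)
Lemma geoM m l : geo m.+1 * geo l.+1 = geo (m + l).+1 + 'X * (geo m * geo l).
Proof.
have -> : geo (m + l).+1 = geo l.+1 + 'X^(l.+1) * geo m.
  by rewrite -geoD; congr geo; lia.
have -> : geo m.+1 = 1 + 'X * geo m by rewrite -add1n geoD geo1 expr1.
have -> : geo l.+1 = geo l + 'X^l by rewrite -addn1 geoD geo1 mulr1.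
by rewrite exprS; ring.
Qed.

(** The set [C] of allowed coefficients lets one argument serve both (ii) and (iii). *)
Variable C : R -> Prop.
Hypotheses (C1 : C 1) (CM : forall x y, C x -> C y -> C (x * y)).

(* The cone over [C] spanned by the interval sums [x^j + ... + x^(d-j)]: all
   palindromic polynomials of darga [d] if [C] is everything, the unimodal ones
   among them if [C] is the set of nonnegative elements. *)
Inductive centered (d : nat) : {poly R} -> Prop :=
| Centered0 : centered d 0
| CenteredD c j m p : C c -> (j.*2 + m)%N = d -> centered d p ->
    centered d (c *: ('X^j * geo m.+1) + p).

Lemma centeredD d p q : centered d p -> centered d q -> centered d (p + q).
Proof.
by move=> p_d q_d; elim: p_d => [|c j m p' Cc jm _ IH]; rewrite ?add0r // -addrA; apply: CenteredD.
Qed.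

Lemma centered_sum d (I : finType) (P : pred I) (F : I -> {poly R}) :
  (forall i, P i -> centered d (F i)) -> centered d (\sum_(i | P i) F i).
Proof. by move=> Fd; apply: big_ind => //; [apply: Centered0|apply: centeredD]. Qed.

Lemma centeredZ d c p : C c -> centered d p -> centered d (c *: p).
Proof.
move=> Cc; elim=> [|c' j m p' Cc' jm _ IH]; first by rewrite scaler0; apply: Centered0.
by rewrite scalerDr scalerA; apply: CenteredD => //; apply: CM.
Qed.

Lemma centered_shift d p j : centered d p -> centered (j.*2 + d) ('X^j * p).
Proof.
elim=> [|c l m p' Cc lm _ IH]; first by rewrite mulr0; apply: Centered0.
rewrite mulrDr -scalerAr mulrA -exprD; apply: CenteredD => //.
by rewrite doubleD -addnA lm.
Qed.

Lemma centered_geo m : centered m (geo m.+1).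
Proof.
rewrite -[geo _]addr0 -[geo _]scale1r -[geo _]mul1r -(expr0 'X).
by apply: CenteredD => //; apply: Centered0.
Qed.

Lemma centered1 : centered 0 1.
Proof. by rewrite -geo1; apply: centered_geo. Qed.

Lemma centered_geoM m l : centered (m + l) (geo m.+1 * geo l.+1).
Proof.
elim: m l => [|m IH] [|l]; rewrite geoM ?geo0 ?mul0r ?mulr0 ?addr0; try exact: centered_geo.
apply: centeredD; first exact: centered_geo.
by rewrite addSn addnS -(add2n (m + l)); apply: (@centered_shift _ _ 1).
Qed.

(** By bilinearity it suffices to multiply two shifted intervals, which is [centered_geoM]. *)
Lemma centeredM d e p q : centered d p -> centered e q -> centered (d + e) (p * q).
Proof.
move=> p_d q_e; elim: p_d => [|c j m p' Cc <- _ IHp].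
  by rewrite mul0r; apply: Centered0.
rewrite mulrDl; apply: centeredD IHp.
elim: q_e => [|c' l m' q' Cc' <- _ IHq]; first by rewrite mulr0; apply: Centered0.
rewrite mulrDr; apply: centeredD IHq.
rewrite -scalerAl -scalerAr scalerA mulrACA -exprD.
apply: centeredZ; first exact: CM.
by rewrite addnACA -doubleD; apply: centered_shift; apply: centered_geoM.
Qed.

Lemma centeredX d p n : centered d p -> centered (n * d) (p ^+ n).
Proof.
move=> p_d; elim: n => [|n IHn]; first exact: centered1.
by rewrite exprS mulSn; apply: centeredM.
Qed.

Lemma coef_shift_geo j m i : ('X^j * geo m.+1)`_i = (j <= i <= j + m)%:R.
Proof.
rewrite coefXnM ltnNge; case: leqP => //= ji.
rewrite (_ : geo m.+1 = \poly_(k < m.+1) 1); last first.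
  by rewrite poly_def; apply: eq_bigr => k _; rewrite scale1r.
by rewrite coef_poly ltnS leq_subLR; case: leqP.
Qed.

Lemma centered_sym d p i : centered d p -> (i <= d)%N -> p`_i = p`_(d - i).
Proof.
move=> p_d id; elim: p_d => [|c j m p' _ jm _ IH]; first by rewrite !coef0.
rewrite !coefD !coefZ !coef_shift_geo IH; congr (_ * _%:R + _).
by apply/eqP; lia.
Qed.

Lemma centered_large d p i : centered d p -> (d < i)%N -> p`_i = 0.
Proof.
move=> p_d di; elim: p_d => [|c j m p' _ jm _ IH]; first by rewrite coef0.
rewrite coefD coefZ coef_shift_geo IH addr0 (_ : _ && _ = false) ?mulr0 //.
by lia.
Qed.

(** The interval from [j] to [d - j] gets the coefficient [p_j - p_(j-1)]; the last hypothesis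
    covers those with [0 < j <= d/2]. *)
Lemma centered_coef d (p : {poly R}) :
  (forall i, (i <= d)%N -> p`_i = p`_(d - i)) ->
  (forall i, (d < i)%N -> p`_i = 0) ->
  C p`_0 -> (forall i, (i.*2.+1 < d)%N -> C (p`_i.+1 - p`_i)) ->
  centered d p.
Proof.
move=> p_sym p_large Cp0 Cp.
pose diff j := if j is j'.+1 then p`_j - p`_j' else p`_0.
have sum_diff m : \sum_(j < m.+1) diff j = p`_m.
  elim: m => [|m IHm]; first by rewrite big_ord1.
  by rewrite big_ord_recr /= IHm addrC subrK.
have -> : p = \sum_(j < d./2.+1) diff j *: ('X^j * geo (d - j.*2).+1).
  apply/polyP => i; rewrite coef_sum.
  under eq_bigr => j _ do rewrite coefZ coef_shift_geo.
  case: (leqP i d) => [id|di]; last first.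
    rewrite p_large // big1 // => j _; have := ltn_ord j => jd.
    by rewrite (_ : _ && _ = false) ?mulr0 //; lia.
  (* In the lower half, the intervals containing the index are those starting at or before it, so
     the differences telescope. *)
  have -> : p`_i = p`_(minn i (d - i)) by case: leqP => // _; apply: p_sym.
  rewrite -sum_diff (big_ord_widen d./2.+1) /=; last by lia.
  rewrite big_mkcond; apply: eq_bigr => j _ /=; have := ltn_ord j => jd.
  rewrite (_ : (_ < _)%N = (j <= i <= j + (d - j.*2))%N) ?mulr_natr ?mulrb //.
  by lia.
apply: centered_sum => -[j jd] _ /=; rewrite -[_ *: _]addr0.
apply: CenteredD; [|lia|exact: Centered0].
by case: j jd => [|j] //= jd; apply: Cp; lia.
Qed.

End Centered.

(** * Centered polynomials versus symmetry and unimodality *)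

Section CenteredDegree.
Variable R : realType.
Implicit Types p : {poly R}.

Lemma coef_gt_degree p i : (degree p < i)%N -> p`_i = 0.
Proof. by move=> pi; rewrite nth_default // (leq_trans (leqSpred _)). Qed.

Lemma symmetric_centered p :
  symmetric_poly p -> centered (fun=> True) (degree p) p.
Proof. by move=> p_sym; apply: centered_coef => // i; apply: coef_gt_degree. Qed.

Lemma symmetric_unimodal_centered p : 0 <= p`_0 ->
  symmetric_poly p -> unimodal_poly p -> centered (fun c => 0 <= c) (degree p) p.
Proof.
move=> p0 p_sym [m [m_le p_incr p_decr]].
apply: centered_coef => // [i|i id]; first exact: coef_gt_degree.
rewrite subr_ge0; case: (ltnP i m) => im; first exact: p_incr.
(* Past the mode, the coefficients do not increase from [i + 1] to [d - i], where [d] is the degree,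
   and symmetry identifies the last one with [p_i]. The case [k = i] only starts the induction. *)
have p_noninc k : (i <= k <= degree p)%N -> p`_k <= p`_i.+1 \/ k = i.
  elim: k => [|k IHk] /andP[ik kd]; first by right; lia.
  move: ik; rewrite leq_eqVlt => /orP[/eqP<-|ik]; first by right.
  left; have := IHk; case: (eqVneq k i) => [->//|ki].
  case; [lia| |lia] => pk.
  by apply: le_trans pk; apply: p_decr; lia.
have := p_noninc (degree p - i)%N; rewrite -p_sym; last lia.
by case; [lia| |lia].
Qed.

(** By symmetry the coefficient at [d] equals the nonzero constant term, so [d] is the true
    degree. *)
Lemma centered_degree C d p : centered C d p -> p`_0 != 0 -> degree p = d.
Proof.
move=> p_d p0; rewrite /degree; suff -> : size p = d.+1 by [].
apply/eqP; rewrite eqn_leq; apply/andP; split.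
  by apply/leq_sizeP => i; apply: centered_large p_d.
rewrite ltnNge; apply/negP => /leq_sizeP/(_ _ (leqnn d)) pd.
by move: p0; rewrite (centered_sym p_d) // subn0 pd eqxx.
Qed.

Lemma centered_symmetric C d p : centered C d p -> p`_0 != 0 -> symmetric_poly p.
Proof.
move=> p_d p0 i; rewrite (centered_degree p_d p0); exact: (centered_sym p_d).
Qed.

Lemma centered_incr d p i : centered (fun c => 0 <= c) d p ->
  (i.*2 < d)%N -> p`_i <= p`_i.+1.
Proof.
move=> p_d id; elim: p_d => [|c j m q c0 jm _ IH]; first by rewrite !coef0.
rewrite !coefD lerD // !coefZ !coef_shift_geo ler_wpM2l // ler_nat.
by lia.
Qed.

Lemma centered_unimodal d p : centered (fun c => 0 <= c) d p -> p`_0 != 0 ->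
  unimodal_poly p.
Proof.
move=> p_d p0; exists d./2; rewrite (centered_degree p_d p0); split=> [|i id|i id].
- by lia.
- by apply: (centered_incr p_d); lia.
(* The upper half is reflected into the lower one. *)
rewrite (centered_sym p_d); last lia.
rewrite [leRHS](centered_sym p_d); last lia.
rewrite (_ : d - i = (d - i.+1).+1)%N; last lia.
by apply: (centered_incr p_d); lia.
Qed.

End CenteredDegree.

(** Used twice: in the field of rational functions for (i), and at a complex number for (iv). *)
Lemma expr_ratio (F : fieldType) (x u h : F) m s : h != 0 -> (2 * s <= m)%N ->
  x ^+ s * u ^+ (2 * s) * h ^+ (m - 2 * s) = h ^+ m * (x * u ^+ 2 / h ^+ 2) ^+ s.
Proof.
move=> h_neq0 s_le; rewrite -[in RHS](subnK s_le) exprD expr_div_n.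
rewrite [(x * _) ^+ _]exprMn -!exprM -[RHS]mulrA [h ^+ (2 * s) * _]mulrC.
by rewrite divfK ?expf_neq0 // mulrC.
Qed.

(** * Evaluation of independence polynomials and real zeros *)

Section RealZeros.
Variable R : realType.
Local Notation toC := (real_complex R).

Lemma horner_map_indep_poly (K : comNzRingType) (f : {rmorphism R -> K})
    (G : sgraph) (z : K) :
  (map_poly f (indep_poly R G)).[z] = \sum_(S : {set G} | independent S) z ^+ #|S|.
Proof.
rewrite indep_polyE rmorph_sum horner_sum; apply: eq_bigr => S _.
by rewrite /= map_polyXn hornerXn.
Qed.

Lemma subst_frac_indep_poly (G : sgraph) (f : {fraction {poly R}}) :
  subst_frac (indep_poly R G) f = \sum_(S : {set G} | independent S) f ^+ #|S|.
Proof.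
exact: (@horner_map_indep_poly {fraction {poly R}} (@tofrac {poly R} \o @polyC R)).
Qed.

Lemma real_root_indep_poly (G : sgraph) (r : R) :
  root (map_poly toC (indep_poly R G)) r%:C%C -> r < 0.
Proof.
rewrite /root horner_map fmorph_eq0 => rG; rewrite ltNge; apply/negP => r0.
by have := indep_poly_gt0 G r0; rewrite (eqP rG) ltxx.
Qed.

(* For non-real [z], comparing [z / (1 + a z)^2] with its conjugate gives
   [|a z| = 1], and then [a z / (1 + a z)^2 = 1 / (2 + 2 Re (a z))] is
   positive. *)
Lemma real_of_ratio (a r : R) (z : R[i]) : 0 <= a -> r < 0 ->
  z = r%:C%C * (1 + a%:C%C * z) ^+ 2 -> z \is Num.real.
Proof.
case: z => x y a0 r0 /eqP; rewrite expr2 eq_complex /= => /andP[/eqP ex /eqP ey].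
rewrite complex_real; apply/eqP/eqP; case: (eqVneq y 0) => // y0.
(* The imaginary part of the equation, divided by [y]. *)
have e1 : 1 = 2 * r * a * (1 + a * x).
  by apply: (mulIf y0); rewrite mul1r {1}ey; ring.
have a_neq0 : a != 0 by apply: contra_eq_neq e1 => ->; rewrite mulr0 mul0r oner_neq0.
have a_gt0 : 0 < a by rewrite lt_def a_neq0.
have ax : a * x + 1 < 0.
  have ra : r * a < 0 by rewrite nmulr_rlt0.
  by rewrite addrC -(nmulr_rgt0 _ ra); lra.
have e2 : (a * x) ^+ 2 + (a * y) ^+ 2 = 1.
  have r_neq0 : r != 0 by rewrite lt_eqF.
  (* The real part, with its left side [x] multiplied by the expression for 1 in [e1], and [r]
     cancelled. *)
  have : 2 * a * x * (1 + a * x) = (1 + a * x) ^+ 2 - (a * y) ^+ 2.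
    apply: (mulfI r_neq0); transitivity x; last by rewrite {1}ex; ring.
    by rewrite -[RHS]mulr1 [X in _ = _ * X]e1; ring.
  nra.
(* [a x < -1] contradicts [(a x)^2 <= 1]. *)
nra.
Qed.

End RealZeros.

(** * The five assertions for the product *)

Section Product.
Variables (R : realType) (G H : sgraph) (Gamma : cycle_cover G) (U : {set H}).
Local Notation N := (#|G| + #|vertex_cycles Gamma|)%N.
Local Notation IG := (indep_poly R G).
Local Notation IH := (indep_poly R H).
Local Notation IHU := (indep_poly R (delete_vertices U)).
Local Notation IP := (indep_poly R (cycle_cover_product Gamma U)).

Lemma indep_poly_productE :
  IP = \sum_(S : {set G} | independent S)
         'X^#|S| * IHU ^+ (2 * #|S|) * IH ^+ (N - 2 * #|S|).
Proof. by rewrite indep_poly_product card_copy. Qed.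

Lemma independent_le (S : {set G}) : independent S -> (2 * #|S| <= N)%N.
Proof. by rewrite -(card_copy Gamma); apply: card_independent_le_copy. Qed.

Lemma tofrac_indep_poly_product :
  tofrac IP = tofrac IH ^+ N *
    subst_frac IG (tofrac 'X * tofrac IHU ^+ 2 / tofrac IH ^+ 2).
Proof.
rewrite subst_frac_indep_poly indep_poly_productE rmorph_sum big_distrr /=.
apply: eq_bigr => S /independent_le S_le; rewrite !rmorphM !rmorphXn /=.
by rewrite expr_ratio // tofrac_eq0 indep_poly_neq0.
Qed.

(** With [s = |S|], the summand has darga [2s + 2sd + (N - 2s)(d + 1) = N(d + 1)], independent of
    [S] because the dargas of [I(H)] and [I(H - U)] differ by one. *)
Lemma centered_product (C : R -> Prop) d : C 1 ->
  (forall x y, C x -> C y -> C (x * y)) ->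
  centered C d.+1 IH -> centered C d IHU -> centered C (N * d.+1) IP.
Proof.
move=> C1 CM H_d HU_d; rewrite indep_poly_productE.
apply: centered_sum => S /independent_le S_le.
have -> : (N * d.+1 = (#|S|.*2 + 2 * #|S| * d) + (N - 2 * #|S|) * d.+1)%N.
  by rewrite -[N in LHS](subnK S_le); lia.
apply: centeredM => //; last exact: centeredX.
by apply: centered_shift; apply: centeredX.
Qed.

Lemma degree_indep_poly (K : sgraph) : degree (indep_poly R K) = alpha K.
Proof. by rewrite /degree size_indep_poly. Qed.

Lemma coef0_indep_poly_neq0 (K : sgraph) : (indep_poly R K)`_0 != 0.
Proof. by rewrite coef0_indep_poly oner_neq0. Qed.

Lemma symmetric_product : alpha H = (alpha (delete_vertices U) + 1)%N ->
  symmetric_poly IH -> symmetric_poly IHU -> symmetric_poly IP.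
Proof.
move=> alphaH /symmetric_centered H_d /symmetric_centered HU_d.
rewrite !degree_indep_poly alphaH addn1 in H_d HU_d.
apply: centered_symmetric (coef0_indep_poly_neq0 _).
exact: (centered_product _ _ H_d HU_d).
Qed.

Lemma unimodal_product : alpha H = (alpha (delete_vertices U) + 1)%N ->
  symmetric_poly IH -> unimodal_poly IH ->
  symmetric_poly IHU -> unimodal_poly IHU -> unimodal_poly IP.
Proof.
move=> alphaH H_sym H_uni HU_sym HU_uni.
have H_d := symmetric_unimodal_centered (coef_indep_poly_ge0 _ _ _) H_sym H_uni.
have HU_d := symmetric_unimodal_centered (coef_indep_poly_ge0 _ _ _) HU_sym HU_uni.
rewrite !degree_indep_poly alphaH addn1 in H_d HU_d.
apply: centered_unimodal (coef0_indep_poly_neq0 _).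
by apply: (centered_product _ _ H_d HU_d) => // x y; apply: mulr_ge0.
Qed.

Lemma only_real_zeros_product (a : R) :
  only_real_zeros IG -> only_real_zeros IH -> IH = IHU * (1 + a *: 'X) ->
  only_real_zeros IP.
Proof.
move=> G_real H_real IHE z.
(* Otherwise [-1/a] would be a positive zero of [I(H)]. *)
have a_ge0 : 0 <= a.
  rewrite leNgt; apply/negP => a_lt0.
  have := @indep_poly_gt0 _ H (- a^-1) _; rewrite oppr_ge0 invr_le0 ltW // => /(_ isT).
  rewrite IHE !hornerE mulrN divff ?lt_eqF // subrr mulr0 ltxx //.
rewrite indep_poly_productE /root rmorph_sum horner_sum.
set toC := real_complex R; set v := (map_poly toC IHU).[z].
set w := 1 + (a%:C)%C * z.
have IHz : (map_poly toC IH).[z] = v * w.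
  by rewrite IHE rmorphM rmorphD rmorph1 /= map_polyZ map_polyX !hornerE.
under eq_bigr => S _ do
  rewrite !rmorphM !rmorphXn /= map_polyX !hornerM !horner_exp hornerX -/v IHz.
(* The zeros of [I(H)] are set aside first: those of [I(H - U)], real by the assumption on [I(H)],
   then [-1/a]. *)
have [v0|v_neq0] := eqVneq v 0.
  by move=> _; apply: H_real; rewrite /root IHz v0 mul0r.
have [w0|w_neq0] := eqVneq w 0.
  move=> _; have a_neq0 : a != 0.
    by apply: contra_eq_neq w0; rewrite /w => ->; rewrite mul0r addr0 oner_neq0.
  have -> : z = (- a^-1)%:C%C.
    apply: (mulfI (x := a%:C%C)); first by rewrite fmorph_eq0.
    by rewrite -rmorphM mulrN divff // rmorphN1; apply/eqP; rewrite -addr_eq0 addrC -/w w0.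
  by apply/complex_realP; exists (- a^-1).
have -> : \sum_(S : {set G} | independent S)
     z ^+ #|S| * v ^+ (2 * #|S|) * (v * w) ^+ (N - 2 * #|S|) =
   (v * w) ^+ N * (map_poly toC IG).[z / w ^+ 2].
  rewrite horner_map_indep_poly big_distrr /=.
  apply: eq_bigr => S /independent_le S_le.
  rewrite expr_ratio ?mulf_neq0 //; congr (_ * _ ^+ _).
  by rewrite exprMn invfM mulrA mulfK ?expf_neq0.
rewrite mulf_eq0 expf_eq0 mulf_eq0 (negbTE v_neq0) (negbTE w_neq0) andbF /=.
move=> rootG; have /complex_realP[r zr] := G_real _ rootG.
rewrite zr in rootG; apply: (real_of_ratio a_ge0 (real_root_indep_poly rootG)).
by rewrite -zr -/w divfK // expf_neq0.
Qed.

End Product.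

(** The independent sets of a complete graph are the empty set and the singletons. *)
Lemma indep_poly_complete (R : nzRingType) p :
  indep_poly R (complete_graph p) = 1 + p%:R *: 'X.
Proof.
rewrite indep_polyE (bigD1 set0) ?independent0 //= cards0 expr0; congr (_ + _).
rewrite (eq_bigl (fun A => A \in [set [set x] | x : 'I_p])); last first.
  move=> A; apply/andP/imsetP => [[/independentP Aind /set0Pn[x xA]]|[x _ ->]].
    exists x => //; apply/setP => y; rewrite inE; apply/idP/eqP => [yA|->//].
    by have := Aind _ _ xA yA; rewrite /= negbK => /eqP.
  split; last by apply/set0Pn; exists x; rewrite inE.
  by apply/independentP => y y'; rewrite !inE => /eqP-> /eqP->; rewrite /= eqxx.
rewrite big_imset /=; last by move=> x y _ _; apply: set1_inj.
under eq_bigr => x _ do rewrite cards1 expr1.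
by rewrite sumr_const card_ord scaler_nat.
Qed.

Lemma indep_poly_delete_all (R : nzRingType) (H : sgraph) :
  indep_poly R (delete_vertices [set: H]) = 1.
Proof.
rewrite indep_poly_delete (big_pred1 set0) ?cards0 // => B.
rewrite disjoints_subset setCT subset0 andbC /=.
by case: eqP => // ->; rewrite independent0.
Qed.

Lemma only_real_zeros_linear (R : realType) (a : R) : only_real_zeros (1 + a *: 'X).
Proof.
move=> z; rewrite /root rmorphD rmorph1 /= map_polyZ map_polyX !hornerE.
case: z => x y; rewrite eq_complex /= => /andP[/eqP ex /eqP ey].
(* For [a = 0] the polynomial is the constant 1, and the real part of the equation reads [1 = 0]. *)
rewrite complex_real; have [a0|a0] := eqVneq a 0.
  by move: ex; rewrite a0; lra.
by apply/eqP/(mulfI a0); move: ey; lra.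
Qed.

Theorem theorem4p1 (R : realType) (G H : sgraph) (Gamma : cycle_cover G)
    (U : {set H}) (n k : nat)
    (hn : #|G| = n) (hk : #|vertex_cycles Gamma| = k) :
  let IG : {poly R} := indep_poly R G in
  let IH : {poly R} := indep_poly R H in
  let IHU : {poly R} := indep_poly R (delete_vertices U) in
  let IP : {poly R} := indep_poly R (cycle_cover_product Gamma U) in
  [/\ tofrac IP =
        tofrac IH ^+ (n + k) *
        subst_frac IG (tofrac 'X * tofrac IHU ^+ 2 / tofrac IH ^+ 2),
      alpha H = (alpha (delete_vertices U) + 1)%N ->
        symmetric_poly IH -> symmetric_poly IHU -> symmetric_poly IP,
      alpha H = (alpha (delete_vertices U) + 1)%N ->
        symmetric_poly IH /\ unimodal_poly IH ->
        symmetric_poly IHU /\ unimodal_poly IHU ->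
        symmetric_poly IP /\ unimodal_poly IP,
      forall a : R,
        only_real_zeros IG -> only_real_zeros IH ->
        IH = IHU * (1 + a *: 'X) ->
        only_real_zeros IP
    & forall p : nat,
        only_real_zeros IG ->
        only_real_zeros
          (indep_poly R
             (cycle_cover_product Gamma [set: complete_graph p]))].
Proof.
subst n k; split.
- exact: tofrac_indep_poly_product.
- exact: symmetric_product.
- move=> alphaH [H_sym H_uni] [HU_sym HU_uni].
  by split; [apply: symmetric_product|apply: unimodal_product].
- exact: only_real_zeros_product.
(* With [U] all of [K_p], [I(H - U) = 1] and [I(H) = 1 + p x], so (iv) applies with [a = p]. *)
- move=> p G_real; apply: (only_real_zeros_product (a := p%:R)) => //.
    by rewrite indep_poly_complete; apply: only_real_zeros_linear.
  by rewrite indep_poly_delete_all mul1r indep_poly_complete.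
Qed.
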